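(* Let $K$ be a field of characteristic $0$, let $q$ be an indeterminate, and let $\mathcal{H}_n(q)$ be the Hecke algebra of the symmetric group $\mathfrak{S}_n$ over $K(q)$, with generators $T_1,\dots,T_{n-1}$ and relations $(T_i+1)(T_i-q)=0$, $T_iT_j=T_jT_i$ for $|i-j|\ge 2$, $T_iT_{i+1}T_i=T_{i+1}T_iT_{i+1}$. For $w\in\mathfrak{S}_n$ with a reduced decomposition $w=s_{a_1}\cdots s_{a_r}$ (where $s_i=(i,i+1)$ and $r$ is the number of inversions of $w$), set $T_w=T_{a_1}\cdots T_{a_r}$; the $T_w$ form a basis of $\mathcal{H}_n(q)$. Let $E_i=\frac{1}{q+1}(q-1-2T_i)$ and define $c_w(q)\in K(q)$ by $$E_1E_2\cdots E_{n-1}\cdot E_1E_2\cdots E_{n-2}\cdots E_1E_2\cdot E_1=\sum_{w\in\mathfrak{S}_n}c_w(q)T_w.$$ Then for the identity permutation $\mathrm{id}$, $$c_{\mathrm{id}}(q)=\left(\frac{q-1}{q+1}\right)^{\lfloor n/2\rfloor}.$$ *)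

(* Defs.v *)
From HB Require Import structures.
From mathcomp Require Import all_boot all_fingroup all_algebra.
From mathcomp Require Import boolp finmap monalg.

Set Implicit Arguments.
Unset Strict Implicit.
Unset Printing Implicit Defensive.

Import GRing.Theory.
Local Open Scope ring_scope.
Local Open Scope quotient_scope.

Inductive ideal_gen (A : nzRingType) (S : A -> Prop) : A -> Prop :=
  | Ideal_gen x : S x -> ideal_gen S x
  | Ideal_0 : ideal_gen S 0
  | Ideal_add x y : ideal_gen S x -> ideal_gen S y -> ideal_gen S (x + y)
  | Ideal_mull a x : ideal_gen S x -> ideal_gen S (a * x)
  | Ideal_mulr a x : ideal_gen S x -> ideal_gen S (x * a).

Section HeckeAlgebra.
Variables (R : comNzRingType) (q : R) (n : nat).

(* Free associative R-algebra on n - 1 generators; the indices 1, ..., n-1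
   of the generators are shifted to 0, ..., n-2. *)
Definition free_alg : lalgType R := {malg R[{fmonom 'I_n.-1}]}.
Definition free_gen (i : 'I_n.-1) : free_alg :=
  (<< fmu i >> : {malg R[{fmonom 'I_n.-1}]}).

Inductive hecke_relator : free_alg -> Prop :=
  | Quadratic_rel (i : 'I_n.-1) :
      hecke_relator ((free_gen i + 1) * (free_gen i - q%:A))
  | Commutation_rel (i j : 'I_n.-1) : ((i.+1 < j) || (j.+1 < i))%N ->
      hecke_relator (free_gen i * free_gen j - free_gen j * free_gen i)
  | Braid_rel (i j : 'I_n.-1) : j = i.+1 :> nat ->
      hecke_relator (free_gen i * free_gen j * free_gen i -
                     free_gen j * free_gen i * free_gen j).

Definition hecke_ideal : {pred free_alg} :=
  fun x => `[< ideal_gen hecke_relator x >].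

Lemma hecke_idealP (x : free_alg) :
  reflect (ideal_gen hecke_relator x) (x \in hecke_ideal).
Proof. exact: asboolP. Qed.

Fact hecke_ideal_zmod_closed : zmod_closed hecke_ideal.
Proof.
split=> [|x y]; first by apply/hecke_idealP; exact: Ideal_0.
move=> /hecke_idealP Ix /hecke_idealP Iy; apply/hecke_idealP.
by rewrite -mulN1r; apply: Ideal_add => //; apply: Ideal_mull.
Qed.
HB.instance Definition _ :=
  GRing.isZmodClosed.Build free_alg hecke_ideal hecke_ideal_zmod_closed.

Lemma hecke_idealMl a x : x \in hecke_ideal -> a * x \in hecke_ideal.
Proof. by move=> /hecke_idealP Ix; apply/hecke_idealP/Ideal_mull. Qed.

Lemma hecke_idealMr a x : x \in hecke_ideal -> x * a \in hecke_ideal.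
Proof. by move=> /hecke_idealP Ix; apply/hecke_idealP/Ideal_mulr. Qed.

Lemma hecke_idealZ a x : x \in hecke_ideal -> a *: x \in hecke_ideal.
Proof. by rewrite -[x]mul1r scalerAl mul1r; apply: hecke_idealMl. Qed.

Lemma free_alg_scalerAr (a : R) (x y : free_alg) :
  a *: (x * y) = x * (a *: y).
Proof.
rewrite -!(@mul_malgC _ R) !mulrA; congr (_ * _).
apply/malgP => k; rewrite mcoeffCM.
rewrite (mcoeffMrw k (fsubset_refl (msupp x)) (msuppC_le a)) big_seq_fset1.
rewrite (eq_bigr (fun k1 => if k1 == k then x@_k1 * a else 0)) => [|k1 _].
  rewrite -big_mkcond -big_filter; case: (boolP (k \in msupp x)) => kx.
    rewrite filter_pred1_uniq ?fset_uniq // big_seq1.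
    exact: mulrC.
  rewrite (mcoeff_outdom kx) mulr0 big_seq big1 // => k1.
  by rewrite mem_filter => /andP[/eqP -> /(negP kx)].
by rewrite mulm1 mcoeffC eqxx mulr1n mulrb.
Qed.

(* The index representation T_i |-> q shows that the quotient is nonzero. *)
Definition index_monom (m : {fmonom 'I_n.-1}) : R := q ^+ size m.
Fact index_monom_mmorphism : mmorphism index_monom.
Proof.
split=> [x y|]; rewrite /index_monom; last by rewrite fm1.
by rewrite fmM size_cat exprD.
Qed.
HB.instance Definition _ :=
  monalg.isMultiplicative.Build _ _ index_monom index_monom_mmorphism.

Lemma hecke_ideal1 : (1 : free_alg) \notin hecke_ideal.
Proof.
pose ev : {rmorphism {malg R[{fmonom 'I_n.-1}]} -> R} :=
  GRing.RMorphism.clone _ _ (mmap (@idfun R) index_monom) _.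
suff I0 (x : free_alg) : ideal_gen hecke_relator x -> ev x = 0.
  apply/hecke_idealP => /I0 /eqP; rewrite rmorph1; exact/negP/oner_neq0.
have E (i : 'I_n.-1) : ev (free_gen i) = q.
  by rewrite /ev /= mmapU mul1r /index_monom fmuE.
have Eq : ev q%:A = q by rewrite /ev /= mmapZ rmorph1 mulr1.
elim=> {x} [x||x y _ IHx _ IHy|a x _ IHx|a x _ IHx].
- case=> [i|i j _|i j _]; rewrite !(rmorphM, rmorphB, rmorphD, rmorph1) !E.
  + by rewrite Eq subrr mulr0.
  + by rewrite subrr.
  + by rewrite subrr.
- by rewrite rmorph0.
- by rewrite rmorphD IHx IHy addr0.
- by rewrite rmorphM IHx mulr0.
- by rewrite rmorphM IHx mul0r.
Qed.

Definition hecke : Type := Quotient.quot hecke_ideal.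
HB.instance Definition _ := GRing.Zmodule.on hecke.

End HeckeAlgebra.

(* Locked so that failed unifications do not unfold the quotient. *)
HB.lock Definition hecke_proj (R : comNzRingType) (q : R) (n : nat)
    (x : free_alg R n) : hecke q n :=
  \pi_(Quotient.quot (hecke_ideal q (n:=n))) x.
HB.lock Definition hecke_repr (R : comNzRingType) (q : R) (n : nat)
    (x : hecke q n) : free_alg R n :=
  generic_quotient.repr (x : Quotient.quot (hecke_ideal q (n:=n))).

HB.lock Definition hecke_one (R : comNzRingType) (q : R) (n : nat) :
    hecke q n :=
  hecke_proj q 1.
HB.lock Definition hecke_mul (R : comNzRingType) (q : R) (n : nat)
    (x y : hecke q n) : hecke q n :=
  hecke_proj q (hecke_repr x * hecke_repr y).
HB.lock Definition hecke_scale (R : comNzRingType) (q : R) (n : nat)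
    (a : R) (x : hecke q n) : hecke q n :=
  hecke_proj q (a *: hecke_repr x).
HB.lock Definition hecke_gen (R : comNzRingType) (q : R) (n : nat)
    (i : 'I_n.-1) : hecke q n :=
  hecke_proj q (free_gen R i).

Section HeckeAlgebraTheory.
Variables (R : comNzRingType) (q : R) (n : nat).
Local Notation hecke := (hecke q n).
Local Notation hecke_ideal := (hecke_ideal q (n:=n)).
Local Notation hecke_proj := (@hecke_proj R q n).
Local Notation hecke_one := (@hecke_one R q n).
Local Notation hecke_mul := (@hecke_mul R q n).
Local Notation hecke_scale := (@hecke_scale R q n).

Lemma hecke_projP x y :
  reflect (hecke_proj x = hecke_proj y) (x - y \in hecke_ideal).
Proof. by rewrite Quotient.idealrBE hecke_proj.unlock; apply: eqP. Qed.

Lemma hecke_reprK (x : hecke) : hecke_proj (hecke_repr x) = x.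
Proof. by rewrite hecke_proj.unlock hecke_repr.unlock; exact: reprK. Qed.

Lemma hecke_proj1 : hecke_proj 1 = hecke_one.
Proof. by rewrite hecke_one.unlock. Qed.

Lemma hecke_proj0 : hecke_proj 0 = 0.
Proof. by rewrite hecke_proj.unlock piE. Qed.

Lemma hecke_projD : {morph hecke_proj : x y / x + y}.
Proof. by move=> x y; rewrite hecke_proj.unlock piE. Qed.

Lemma hecke_projM x y :
  hecke_proj (x * y) = hecke_mul (hecke_proj x) (hecke_proj y).
Proof.
rewrite hecke_mul.unlock; apply/hecke_projP.
set x' := hecke_repr _; set y' := hecke_repr (hecke_proj y).
have -> : x * y - x' * y' = x * (y - y') + (x - x') * y'.
  by rewrite mulrBr mulrBl addrA subrK.
apply: rpredD; [apply: hecke_idealMl | apply: hecke_idealMr];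
  by apply/hecke_projP; rewrite hecke_reprK.
Qed.

Lemma hecke_projZ a x : hecke_proj (a *: x) = hecke_scale a (hecke_proj x).
Proof.
rewrite hecke_scale.unlock; apply/hecke_projP; rewrite -scalerBr; apply: hecke_idealZ.
by apply/hecke_projP; rewrite hecke_reprK.
Qed.

Local Ltac lift_hecke :=
  repeat match goal with x : hecke |- _ =>
    rewrite -(hecke_reprK x); move: (hecke_repr x) => {}x end;
  rewrite -?hecke_proj1 -?(hecke_projM, hecke_projD, hecke_projZ).

Fact hecke_mulA : associative hecke_mul.
Proof. by move=> x y z; lift_hecke; rewrite mulrA. Qed.
Fact hecke_mul1l : left_id hecke_one hecke_mul.
Proof. by move=> x; lift_hecke; rewrite mul1r. Qed.
Fact hecke_mulr1 : right_id hecke_one hecke_mul.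
Proof. by move=> x; lift_hecke; rewrite mulr1. Qed.
Fact hecke_mulDl : left_distributive hecke_mul +%R.
Proof. by move=> x y z; lift_hecke; rewrite mulrDl. Qed.
Fact hecke_mulDr : right_distributive hecke_mul +%R.
Proof. by move=> x y z; lift_hecke; rewrite mulrDr. Qed.
Fact hecke_one_neq0 : hecke_one != 0.
Proof.
apply/eqP => one0; move/negP: (hecke_ideal1 q n); apply.
by rewrite -[1]subr0; apply/hecke_projP; rewrite hecke_proj1 one0 hecke_proj0.
Qed.
HB.instance Definition _ := GRing.Zmodule_isNzRing.Build hecke
  hecke_mulA hecke_mul1l hecke_mulr1 hecke_mulDl hecke_mulDr hecke_one_neq0.

Fact hecke_scaleA a b x : hecke_scale a (hecke_scale b x) = hecke_scale (a * b) x.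
Proof. by lift_hecke; rewrite scalerA. Qed.
Fact hecke_scale1 : left_id 1 hecke_scale.
Proof. by move=> x; lift_hecke; rewrite scale1r. Qed.
Fact hecke_scaleDr : right_distributive hecke_scale +%R.
Proof. by move=> a x y; lift_hecke; rewrite scalerDr. Qed.
Fact hecke_scaleDl x : {morph hecke_scale^~ x : a b / a + b}.
Proof. by move=> a b; lift_hecke; rewrite scalerDl. Qed.
HB.instance Definition _ := GRing.Zmodule_isLmodule.Build R hecke
  hecke_scaleA hecke_scale1 hecke_scaleDr hecke_scaleDl.

Fact hecke_scaleAl (a : R) (x y : hecke) : a *: (x * y) = (a *: x) * y.
Proof.
change (hecke_scale a (hecke_mul x y) = hecke_mul (hecke_scale a x) y).
by lift_hecke; rewrite scalerAl.
Qed.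
HB.instance Definition _ := GRing.Lmodule_isLalgebra.Build R hecke hecke_scaleAl.

Fact hecke_scaleAr (a : R) (x y : hecke) : a *: (x * y) = x * (a *: y).
Proof.
change (hecke_scale a (hecke_mul x y) = hecke_mul x (hecke_scale a y)).
by lift_hecke; rewrite free_alg_scalerAr.
Qed.
HB.instance Definition _ := GRing.Lalgebra_isAlgebra.Build R hecke hecke_scaleAr.

Definition hecke_word (a : seq 'I_n.-1) : hecke :=
  \prod_(i <- a) hecke_gen q i.

End HeckeAlgebraTheory.

Section Permutations.
Variable n : nat.

Fact adj_ltn0 (i : 'I_n.-1) : (i < n)%N.
Proof. by rewrite (leq_trans (ltn_ord i)) ?leq_pred. Qed.
Fact adj_ltn1 (i : 'I_n.-1) : (i.+1 < n)%N.
Proof. by rewrite -ltn_predRL. Qed.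

Definition adj_transp (i : 'I_n.-1) : 'S_n :=
  tperm (Ordinal (adj_ltn0 i)) (Ordinal (adj_ltn1 i)).

Definition inversions (w : 'S_n) : {set 'I_n * 'I_n} :=
  [set ij : 'I_n * 'I_n | (ij.1 < ij.2)%N && (w ij.2 < w ij.1)%N].

(* The product of 'S_n composes left to right; with the opposite convention w
   is replaced by its inverse, which has as many inversions. *)
Definition reduced_decomposition (w : 'S_n) (a : seq 'I_n.-1) : Prop :=
  w = (\prod_(i <- a) adj_transp i)%g /\ size a = #|inversions w|.

End Permutations.

Section GenericParameter.
Variables (K : fieldType) (n : nat).

Definition qvar : {fraction {poly K}} := tofrac 'X.

Definition hecke_E (i : 'I_n.-1) : hecke qvar n :=
  (qvar + 1)^-1 *: ((qvar - 1)%:A - 2%:R *: hecke_gen qvar i).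

(* With k counted from 0, the inner product is E_1 ... E_(n-1-k). *)
Definition hecke_Eprod : hecke qvar n :=
  \prod_(k < n.-1) \prod_(i < n.-1 | (i < n.-1 - k)%N) hecke_E i.

End GenericParameter.

(* Main.v *)
(* On functions on S_n, the operators of left and right multiplication by T_i
   commute and satisfy the Hecke relations, so h |-> h.1 identifies the Hecke
   algebra with these functions (T_w being sent to the indicator of w), and
   the coefficient of T_id is a trace. The E_i are involutions with E_i E_j =
   E_j E_i for |i - j| > 1. Put C_m = E_1 ... E_m and W_(m+1) = C_m W_m. The
   staircase products W_m are involutions and
   W_(m+2) = C_m (E_(m+1) W_m) C_m^-1. Hence W_(m+2) and E_(m+1) W_m have the
   same trace. Since W_m lies in the subalgebra generated by T_1, ...,
   T_(m-1), the trace of T_(m+1) W_m vanishes, so that the trace of W_(m+2) is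
   (q - 1) / (q + 1) times that of W_m. *)
Require Import Defs.
From HB Require Import structures.
From mathcomp Require Import all_boot all_fingroup all_algebra.
From mathcomp Require Import finmap monalg zify ring.

Set Implicit Arguments.
Unset Strict Implicit.
Unset Printing Implicit Defensive.

Import GRing.Theory.
Local Open Scope ring_scope.

(** * Descents, inversions and reduced words *)

Section Descents.
Variable n : nat.
Implicit Types (i j : 'I_n.-1) (w : 'S_n).

Definition adj_lo i : 'I_n := Ordinal (adj_ltn0 i).
Definition adj_hi i : 'I_n := Ordinal (adj_ltn1 i).

Definition descent i w : bool := (w (adj_hi i) < w (adj_lo i))%N.

Lemma adj_transpL i : adj_transp i (adj_lo i) = adj_hi i.
Proof. exact: tpermL. Qed.

Lemma adj_transpR i : adj_transp i (adj_hi i) = adj_lo i.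
Proof. exact: tpermR. Qed.

Lemma adj_transpK i : involutive (adj_transp i).
Proof. exact: tpermK. Qed.

Lemma mulg_adjK i : (adj_transp i * adj_transp i)%g = 1%g.
Proof. exact: tperm2. Qed.

Lemma mulg_adjKl i w : (adj_transp i * (adj_transp i * w))%g = w.
Proof. by rewrite mulgA mulg_adjK mul1g. Qed.

Lemma adj_transpV i : ((adj_transp i)^-1)%g = adj_transp i.
Proof. exact: tpermV. Qed.

Lemma val_adj_transp i (x : 'I_n) :
  adj_transp i x = (if x == i :> nat then i.+1
                    else if x == i.+1 :> nat then i : nat else x) :> nat.
Proof.
rewrite /adj_transp; case: tpermP => [->|->|/eqP xlo /eqP xhi] //=.
- by rewrite eqxx.
- by rewrite gtn_eqF // eqxx.
by rewrite -val_eqE in xlo; rewrite -val_eqE in xhi; rewrite (negPf xlo) (negPf xhi).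
Qed.

Lemma adj_transp_lt i (x y : 'I_n) :
  (adj_transp i x < adj_transp i y)%N =
  if (x == adj_lo i) && (y == adj_hi i) then false
  else if (x == adj_hi i) && (y == adj_lo i) then true else (x < y)%N.
Proof.
rewrite !val_adj_transp -!val_eqE /=.
by do ![case: eqP => /=] => *; lia.
Qed.

Lemma descent_mul_adj i w : descent i (adj_transp i * w)%g = ~~ descent i w.
Proof.
rewrite /descent !permM adj_transpL adj_transpR -leqNgt ltn_neqAle.
suff -> : w (adj_lo i) != w (adj_hi i) :> nat by [].
by rewrite val_eqE (inj_eq perm_inj) -val_eqE /= ltn_eqF.
Qed.

(** Applying s_i to both positions of a pair keeps their order unless the pair is {i, i+1}. This
    matches the inversions of [adj_transp i * w] with those of [w], except for
    [(adj_lo i, adj_hi i)], which is inverted by [w] only. *)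
Lemma card_inversions_descent i w : descent i w ->
  #|inversions w| = #|inversions (adj_transp i * w)%g|.+1.
Proof.
move=> dw; pose s := adj_transp i; pose f (x : 'I_n * 'I_n) := (s x.1, s x.2).
have fK : involutive f by case=> x y; rewrite /f /= !adj_transpK.
suff -> : inversions w = (adj_lo i, adj_hi i) |: f @: inversions (s * w)%g.
  rewrite cardsU1 card_imset; last exact: inv_inj.
  case: imsetP => [[[x y]]|//]; rewrite inE => /andP[/= lt_xy _] [lo hi].
  by move: lt_xy; rewrite -(adj_transpK i x) -(adj_transpK i y) -lo -hi
    adj_transpL adj_transpR /= ltnNge leqnSn.
apply/setP=> -[x y]; rewrite in_setU1 -[(x, y) in X in _ || X]fK.
rewrite mem_imset; last exact: inv_inj.
rewrite !inE /= !permM !adj_transpK adj_transp_lt xpair_eqE.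
have [/andP[/eqP-> /eqP->]|_] /= := boolP ((x == adj_lo i) && _).
  by rewrite leqnn /=; exact: dw.
have [/andP[/eqP-> /eqP->]|//] := boolP ((x == adj_hi i) && _).
rewrite /= ltnNge leqnSn /=; move: dw; rewrite /descent => dw.
by rewrite ltnNge ltnW.
Qed.

Lemma card_inversions_ascent i w : ~~ descent i w ->
  #|inversions (adj_transp i * w)%g| = #|inversions w|.+1.
Proof.
rewrite -descent_mul_adj => /card_inversions_descent ->.
by rewrite mulg_adjKl.
Qed.

Lemma card_inversions1 : #|inversions (1 : 'S_n)%g| = 0%N.
Proof.
apply/eqP; rewrite cards_eq0; apply/eqP/setP => -[x y].
by rewrite !inE !perm1 /=; case: ltngtP.
Qed.

Lemma card_inversions_prod (a : seq 'I_n.-1) :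
  (#|inversions (\prod_(i <- a) adj_transp i)%g| <= size a)%N.
Proof.
elim: a => [|i a IHa]; first by rewrite big_nil card_inversions1.
rewrite big_cons /=; set w := (\prod_(j <- a) _)%g in IHa *.
case: (boolP (descent i w)) => [/card_inversions_descent e|/card_inversions_ascent->//].
by rewrite e in IHa; exact/ltnW/ltnW.
Qed.

(** At an ascent [adj_transp i * w] would have more inversions than [w]; but it is the product of
    [a], which has one letter fewer than [w] has inversions. *)
Lemma reduced_cons i w a : reduced_decomposition w (i :: a) ->
  descent i w /\ reduced_decomposition (adj_transp i * w)%g a.
Proof.
case=> /=; rewrite big_cons => ew sz.
have ea : (\prod_(j <- a) adj_transp j)%g = (adj_transp i * w)%g.
  by rewrite ew mulg_adjKl.
have := card_inversions_prod a; rewrite ea.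
case: (boolP (descent i w)) => [d|/card_inversions_ascent->].
  by split=> //; split=> //; move: sz; rewrite (card_inversions_descent d) => -[].
by rewrite -sz => /ltnW; rewrite ltnn.
Qed.

Lemma cons_reduced i w a : descent i w ->
  reduced_decomposition (adj_transp i * w)%g a -> reduced_decomposition w (i :: a).
Proof.
move=> d [ea sz]; split; first by rewrite big_cons -ea mulg_adjKl.
by rewrite /= sz (card_inversions_descent d).
Qed.

Lemma reduced1 (a : seq 'I_n.-1) : reduced_decomposition 1%g a -> a = [::].
Proof. by case=> _; rewrite card_inversions1 => /size0nil. Qed.

Lemma adj_transp_comm i j : (i.+1 < j)%N ->
  (adj_transp i * adj_transp j)%g = (adj_transp j * adj_transp i)%g.
Proof.
move=> ij; apply/permP => x; rewrite !permM; apply: val_inj => /=.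
by rewrite !val_adj_transp; do ![case: eqP => /=] => *; lia.
Qed.

Lemma adj_transp_braid i j : j = i.+1 :> nat ->
  (adj_transp i * (adj_transp j * adj_transp i))%g =
  (adj_transp j * (adj_transp i * adj_transp j))%g.
Proof.
move=> ij; apply/permP => x; rewrite !permM; apply: val_inj => /=.
by rewrite !val_adj_transp; do ![case: eqP => /=] => *; lia.
Qed.

Lemma descent_far i j w : (i.+1 < j)%N || (j.+1 < i)%N ->
  descent i (adj_transp j * w)%g = descent i w.
Proof.
move=> ij; rewrite /descent !permM.
suff e x : (x == adj_lo i) || (x == adj_hi i) -> adj_transp j x = x.
  by rewrite !e ?eqxx ?orbT.
rewrite -!val_eqE /= => ex; apply: val_inj => /=; rewrite val_adj_transp.
by do ![case: eqP => /=] => *; lia.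
Qed.

(** The conjugate of s_i by [w] transposes the images of i and i+1. This settles the exceptional
    cases in the commutation of left and right multiplications. *)
Lemma adj_transp_conj i j w :
  (w (adj_lo i) == adj_lo j) && (w (adj_hi i) == adj_hi j)
  || (w (adj_lo i) == adj_hi j) && (w (adj_hi i) == adj_lo j) ->
  (adj_transp i * w)%g = (w * adj_transp j)%g.
Proof.
have e : (adj_transp i * w)%g =
    (w * tperm (w (adj_lo i)) (w (adj_hi i)))%g.
  by rewrite -tpermJ /conjg !mulgA mulgV mul1g.
by rewrite e => /orP[] /andP[/eqP-> /eqP->]; rewrite // tpermC.
Qed.

End Descents.

(** * Left and right regular representations on functions *)

Section RegularRepresentation.
Variables (R : comNzRingType) (q : R) (n : nat).
Local Notation V := {ffun 'S_n -> R}.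
Implicit Types (i j : 'I_n.-1) (w : 'S_n) (f g : V).

Definition delta w : V := [ffun u => (u == w)%:R].

(* Multiplication by T_i on the left and on the right, an element
   \sum_w f w *: T_w being represented by its coefficient function f. *)
Definition opL i f : V := [ffun w =>
  if descent i w then f (adj_transp i * w)%g + (q - 1) * f w
  else q * f (adj_transp i * w)%g].
Definition opR i f : V := [ffun w =>
  if descent i w^-1%g then f (w * adj_transp i)%g + (q - 1) * f w
  else q * f (w * adj_transp i)%g].

Definition scaleV (c : R) f : V := [ffun w => c * f w].

Lemma opL_additive i : additive (opL i).
Proof. by move=> f g; apply/ffunP => w; rewrite !ffunE /=; case: ifP => _; ring. Qed.
HB.instance Definition _ i := GRing.isAdditive.Build V V (opL i) (opL_additive i).

Lemma opLZ i c f : opL i (scaleV c f) = scaleV c (opL i f).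
Proof. by apply/ffunP => w; rewrite !ffunE; case: ifP => _; ring. Qed.

Lemma opL_quad i f :
  opL i (opL i f) = scaleV (q - 1) (opL i f) + scaleV q f.
Proof.
apply/ffunP => w; rewrite !ffunE !mulg_adjKl descent_mul_adj.
by case: (descent i w) => /=; ring.
Qed.

Lemma opL_comm i j f : (i.+1 < j)%N -> opL i (opL j f) = opL j (opL i f).
Proof.
move=> ij; apply/ffunP => w; rewrite !ffunE !descent_far ?ij ?orbT //.
rewrite !mulgA (adj_transp_comm ij).
by do 2!case: ifP => _; ring.
Qed.

Lemma opL_braid i j f : j = i.+1 :> nat ->
  opL i (opL j (opL i f)) = opL j (opL i (opL j f)).
Proof.
move=> ij; apply/ffunP => w.
have lo_j : adj_lo j = adj_hi i by apply: val_inj.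
have fix_i : adj_transp i (adj_hi j) = adj_hi j.
  by apply: val_inj => /=; rewrite val_adj_transp /=; do ![case: eqP] => *; lia.
have fix_j : adj_transp j (adj_lo i) = adj_lo i.
  by apply: val_inj => /=; rewrite val_adj_transp /=; do ![case: eqP] => *; lia.
have jL : adj_transp j (adj_hi i) = adj_hi j by rewrite -lo_j adj_transpL.
rewrite !ffunE /descent lo_j.
rewrite !(permM, fix_i, fix_j, jL, adj_transpL, adj_transpR, lo_j) !mulg_adjKl.
(* The two sides evaluate [f] at the longest element of the group of s_i and s_j, times [w], written
   by its two reduced words. *)
have -> : (adj_transp i * (adj_transp j * (adj_transp i * w)))%g =
          (adj_transp j * (adj_transp i * (adj_transp j * w)))%g.
  by rewrite !mulgA -!(mulgA _ _ (adj_transp _)) adj_transp_braid.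
have neq x y : x != y -> w x <> w y :> nat.
  by move=> /eqP xy /val_inj/perm_inj.
have := neq (adj_lo i) (adj_hi i); rewrite -val_eqE /= ltn_eqF // => /(_ isT) n1.
have := neq (adj_lo i) (adj_hi j); rewrite -val_eqE /= ij ltn_eqF // => /(_ isT) n2.
have := neq (adj_hi i) (adj_hi j); rewrite -val_eqE /= ij ltn_eqF // => /(_ isT) n3.
(* Only the relative order of three distinct values matters from here on, so finitely many
   polynomial identities remain. *)
move: (nat_of_ord (w (adj_lo i))) (nat_of_ord (w (adj_hi i)))
  (nat_of_ord (w (adj_hi j))) n1 n2 n3 => x y z n1 n2 n3.
by do ![case: ltnP => ?]; (try lia); ring.
Qed.

(** Right multiplication by s_j can change whether [i] is a descent only if [w] maps {i, i+1} onto
    {j, j+1}, and then s_i w = w s_j. Elsewhere the left and right descent conditions do not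
    interact. *)
Lemma opLR_comm i j f : opL i (opR j f) = opR j (opL i f).
Proof.
apply/ffunP => w; rewrite !ffunE !mulgA.
have dL : descent i (w * adj_transp j)%g =
    (adj_transp j (w (adj_hi i)) < adj_transp j (w (adj_lo i)))%N.
  by rewrite /descent !permM.
have dR : descent j (adj_transp i * w)^-1%g =
    (adj_transp i (w^-1%g (adj_hi j)) < adj_transp i (w^-1%g (adj_lo j)))%N.
  by rewrite invMg adj_transpV /descent !permM.
rewrite dL dR !adj_transp_lt.
have eV x y : (w^-1%g x == y) = (w y == x).
  by rewrite (can2_eq (permKV w) (permK w)) eq_sym.
rewrite !eV !(andbC (w (adj_hi i) == _)).
have [/andP[/eqP elo /eqP ehi]|nA] := boolP ((w (adj_lo i) == adj_hi j) && _).
  rewrite (@adj_transp_conj _ i j w); last by rewrite elo ehi !eqxx orbT.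
  rewrite /descent -{1 2}elo -{1 2}ehi !permK elo ehi /= leqnn.
  by rewrite ltnSn; ring.
have [/andP[/eqP elo /eqP ehi]|nB] := boolP ((w (adj_lo i) == adj_lo j) && _).
  rewrite (@adj_transp_conj _ i j w); last by rewrite elo ehi !eqxx.
  rewrite /descent -{1 2}elo -{1 2}ehi !permK elo ehi /= !ltnNge !leqnSn /=.
  by ring.
rewrite -!/(descent _ _).
by do 2!case: ifP => _; ring.
Qed.

Lemma opL_delta1 i : opL i (delta 1%g) = opR i (delta 1%g).
Proof.
apply/ffunP => w; rewrite !ffunE.
have -> : ((adj_transp i * w)%g == 1%g) = (w == adj_transp i).
  by rewrite -eq_invg_mul adj_transpV eq_sym.
have -> : ((w * adj_transp i)%g == 1%g) = (w == adj_transp i).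
  by rewrite [RHS]eq_mulgV1 adj_transpV.
have [-> | _] := eqVneq w (adj_transp i); first by rewrite adj_transpV.
have [-> | _] := eqVneq w 1%g; first by rewrite invg1.
by rewrite !mulr0 addr0 !if_same.
Qed.

Lemma opL_delta i w : descent i w -> opL i (delta (adj_transp i * w)%g) = delta w.
Proof.
move=> d; apply/ffunP => u; rewrite !ffunE (inj_eq (mulgI _)).
have [-> | _] := eqVneq u w.
  have -> : (w == (adj_transp i * w)%g) = false.
    by apply/eqP => e; have := descent_mul_adj i w; rewrite -e d.
  by rewrite d mulr0 addr0.
have [-> | _] := eqVneq u (adj_transp i * w)%g.
  by rewrite descent_mul_adj d mulr0.
by rewrite !mulr0 addr0 if_same.
Qed.

End RegularRepresentation.

(** * The free algebra and its action on functions *)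

Section FreeAlgebra.
Variables (R : comNzRingType) (n : nat).

Definition free_mon (s : seq 'I_n.-1) : free_alg R n :=
  (<< FMonom s >> : {malg R[{fmonom 'I_n.-1}]}).

Lemma free_mon_nil : free_mon [::] = 1.
Proof.
rewrite /free_mon (_ : FMonom [::] = mone) //.
by apply/val_inj; rewrite /= fm1.
Qed.

Lemma free_mon_cons i s : free_mon (i :: s) = free_gen R i * free_mon s.
Proof.
rewrite /free_mon /free_gen malgM_def fgmulUU mulr1; congr << _ *g _ >>.
by apply/val_inj; rewrite /= fmM fmuE.
Qed.

Lemma free_monE (x : {malg R[{fmonom 'I_n.-1}]}) :
  x = \sum_(m <- msupp x) (mcoeff m x *: free_mon m : free_alg R n).
Proof.
rewrite {1}[x]monalgE; apply: eq_bigr => -[s] _; apply/malgP => k.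
by rewrite /free_mon mcoeffZ !mcoeffU mulrnAr mulr1.
Qed.

Lemma free_alg_mon_ind (P : free_alg R n -> Prop) :
  (forall x y, P x -> P y -> P (x + y)) -> (forall c x, P x -> P (c *: x)) ->
  (forall s, P (free_mon s)) -> forall x, P x.
Proof.
move=> PD PZ Pm x; rewrite [x]free_monE.
elim/big_ind: _ => [||m _]; [|exact: PD|exact/PZ].
by rewrite -(scale0r (free_mon [::])); apply: PZ.
Qed.

Lemma free_alg_ind (P : free_alg R n -> Prop) :
  (forall x y, P x -> P y -> P (x + y)) -> (forall c x, P x -> P (c *: x)) ->
  P 1 -> (forall i x, P x -> P (free_gen R i * x)) -> forall x, P x.
Proof.
move=> PD PZ P1 Pg; apply: free_alg_mon_ind => //.
by elim=> [|i s IHs]; rewrite ?free_mon_nil ?free_mon_cons //; apply: Pg.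
Qed.

End FreeAlgebra.

(** The orbit map of [delta 1]: a word acts through the operators [opL] of its letters, its last
    letter first. *)
HB.lock Definition free_coef (R : comNzRingType) (q : R) (n : nat)
    (x : free_alg R n) : {ffun 'S_n -> R} := [ffun w =>
  mmap idfun (fun m : {fmonom 'I_n.-1} =>
    foldr (@opL R q n) (delta R 1%g) m w) (x : {malg R[{fmonom 'I_n.-1}]})].

(** * Coefficient functions and the trace on the Hecke algebra *)

Section Coefficients.
Variables (R : comNzRingType) (q : R) (n : nat).
Local Notation V := {ffun 'S_n -> R}.
Local Notation delta := (@delta R n).
Local Notation free_coef := (@free_coef R q n).
Local Notation opL := (@opL R q n).
Local Notation opR := (@opR R q n).
Implicit Types (i j : 'I_n.-1) (w : 'S_n).

Lemma hecke_genE i : hecke_gen q i = hecke_proj q (free_gen R i).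
Proof. by rewrite hecke_gen.unlock. Qed.

Lemma hecke_ind (P : hecke q n -> Prop) :
  (forall x y, P x -> P y -> P (x + y)) -> (forall c x, P x -> P (c *: x)) ->
  P 1 -> (forall i x, P x -> P (hecke_gen q i * x)) -> forall x, P x.
Proof.
move=> PD PZ P1 Pg x; rewrite -(hecke_reprK x).
elim/free_alg_ind: (hecke_repr x) => [y z Py Pz|c y Py||i y Py].
- by rewrite hecke_projD; apply: PD.
- by rewrite hecke_projZ; apply: PZ.
- by rewrite hecke_proj1.
- by rewrite hecke_projM -hecke_genE; apply: Pg.
Qed.

Lemma free_coefB x y : free_coef (x - y) = free_coef x - free_coef y.
Proof. by rewrite free_coef.unlock; apply/ffunP => w; rewrite !ffunE mmapB. Qed.
HB.instance Definition _ :=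
  GRing.isAdditive.Build (free_alg R n) V free_coef free_coefB.

Lemma free_coefD x y : free_coef (x + y) = free_coef x + free_coef y.
Proof. exact: raddfD. Qed.

Lemma free_coefZ c x : free_coef (c *: x) = scaleV c (free_coef x).
Proof.
rewrite free_coef.unlock; apply/ffunP => w.
rewrite !ffunE (mmapEw (msuppZ_le _ _)) mmapE big_distrr /=.
by apply/eq_bigr=> k _; rewrite mcoeffZ mulrA.
Qed.

Lemma free_coef_mon s : free_coef (free_mon R s) = foldr opL (delta 1%g) s.
Proof.
by rewrite free_coef.unlock; apply/ffunP => w; rewrite ffunE mmapU /= mul1r.
Qed.

Lemma free_coef1 : free_coef 1 = delta 1%g.
Proof. by rewrite -free_mon_nil free_coef_mon. Qed.

(* A failed unification of two distinct products in free_alg is very slow, hence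
   the applications of etrans and congr2 where rewriting would try one. *)
Lemma free_coefMgen i x :
  free_coef (free_gen R i * x) = opL i (free_coef x).
Proof.
elim/free_alg_mon_ind: x => [x y IHx IHy|c x IHx|s].
- by rewrite mulrDr (etrans (free_coefD _ _) (congr2 _ IHx IHy)) free_coefD raddfD.
- rewrite -free_alg_scalerAr; apply: etrans (free_coefZ _ _) _.
  by apply: etrans (congr1 _ IHx) _; rewrite free_coefZ opLZ.
- by rewrite -free_mon_cons !free_coef_mon.
Qed.

Lemma scaleV0 c : scaleV c (0 : V) = 0.
Proof. by apply/ffunP => w; rewrite !ffunE mulr0. Qed.

(** The kernel of an orbit map is a left ideal. *)
Lemma free_coefM_eq0 x y : free_coef y = 0 -> free_coef (x * y) = 0.
Proof.
move=> y0; elim/free_alg_ind: x => [x z x0 z0|c x x0||i x x0].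
- by rewrite mulrDl (etrans (free_coefD _ _) (congr2 _ x0 z0)) addr0.
- by rewrite -scalerAl free_coefZ x0 scaleV0.
- by rewrite mul1r.
- by rewrite -mulrA free_coefMgen x0 raddf0.
Qed.

Lemma free_coef_ideal x : x \in hecke_ideal q (n:=n) -> free_coef x = 0.
Proof.
(* The kernel is so far known to be a left ideal only. Proving that [x * y] vanishes for every [y]
   lets the induction pass through right multiples as well. *)
move=> /hecke_idealP Ix; rewrite -[x]mulr1; move: (1 : free_alg R n) => y.
elim: Ix y => {x} [x rx||x z _ IHx _ IHz|a x _ IHx|a x _ IHx] y.
- case: rx => {x} [i|i j ij|i j ij].
  + have e : free_coef ((free_gen R i - q%:A) * y) =
        opL i (free_coef y) - scaleV q (free_coef y).
      have e : free_coef (q%:A * y) = scaleV q (free_coef y).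
        by rewrite -scalerAl mul1r free_coefZ.
      rewrite mulrBl; apply: etrans (free_coefB _ _) _.
      exact: (congr2 (fun f g => f - g) (free_coefMgen _ _) e).
    rewrite -mulrA mulrDl mul1r.
    rewrite (etrans (free_coefD _ _) (congr2 _ (free_coefMgen _ _) e)) e.
    rewrite raddfB /= opLZ opL_quad.
    by apply/ffunP => w; rewrite !ffunE; ring.
  + have e k l : free_coef (free_gen R k * free_gen R l * y) =
        opL k (opL l (free_coef y)).
      by rewrite -mulrA free_coefMgen free_coefMgen.
    rewrite mulrBl; apply: etrans (free_coefB _ _) _.
    rewrite (congr2 (fun f g => f - g) (e i j) (e j i)).
    by case/orP: ij => /(opL_comm q (free_coef y)) ->; rewrite subrr.
  + have e k l : free_coef (free_gen R k * free_gen R l * free_gen R k * y) =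
        opL k (opL l (opL k (free_coef y))).
      by rewrite -!mulrA free_coefMgen free_coefMgen free_coefMgen.
    rewrite mulrBl; apply: etrans (free_coefB _ _) _.
    rewrite (congr2 (fun f g => f - g) (e i j) (e j i)).
    by rewrite (opL_braid q (free_coef y) ij) subrr.
- by rewrite mul0r; exact: raddf0.
- by rewrite mulrDl (etrans (free_coefD _ _) (congr2 _ (IHx _) (IHz _))) addr0.
- by rewrite -mulrA free_coefM_eq0.
- by rewrite -mulrA IHx.
Qed.

Definition hecke_coef (h : hecke q n) : V := free_coef (hecke_repr h).

Lemma hecke_coef_proj x : hecke_coef (hecke_proj q x) = free_coef x.
Proof.
apply/eqP; rewrite /hecke_coef -subr_eq0 -free_coefB; apply/eqP/free_coef_ideal.
by apply/hecke_projP; rewrite hecke_reprK.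
Qed.

Lemma hecke_coefD x y : hecke_coef (x + y) = hecke_coef x + hecke_coef y.
Proof.
by rewrite -(hecke_reprK x) -(hecke_reprK y) -hecke_projD !hecke_coef_proj free_coefD.
Qed.

Lemma hecke_coefZ c x : hecke_coef (c *: x) = scaleV c (hecke_coef x).
Proof.
by rewrite -(hecke_reprK x) -[c *: _]hecke_projZ !hecke_coef_proj free_coefZ.
Qed.

Lemma hecke_coef1 : hecke_coef 1 = delta 1%g.
Proof. by rewrite -[1]hecke_proj1 hecke_coef_proj free_coef1. Qed.

Lemma hecke_coefMgen i x : hecke_coef (hecke_gen q i * x) = opL i (hecke_coef x).
Proof.
rewrite -(hecke_reprK x) hecke_genE -[_ * _]hecke_projM.
by rewrite !hecke_coef_proj free_coefMgen.
Qed.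

(** Build [x] from 1 by left multiplications: [opR i] commutes with each [opL j], and [opL i] and
    [opR i] agree on [delta 1]. *)
Lemma hecke_coefM_gen i x : hecke_coef (x * hecke_gen q i) = opR i (hecke_coef x).
Proof.
elim/hecke_ind: x => [x y IHx IHy|c x IHx||j x IHx].
- rewrite mulrDl !hecke_coefD IHx IHy; apply/ffunP => w; rewrite !ffunE.
  by case: ifP => _; ring.
- rewrite -scalerAl !hecke_coefZ IHx; apply/ffunP => w; rewrite !ffunE.
  by case: ifP => _; ring.
- by rewrite mul1r -[hecke_gen q i]mulr1 hecke_coefMgen hecke_coef1 opL_delta1.
- by rewrite -mulrA !hecke_coefMgen IHx opLR_comm.
Qed.

Definition hecke_trace (h : hecke q n) : R := hecke_coef h 1%g.

(** It suffices to move one generator across, and [opL i] and [opR i] are given by the same formula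
    at the identity permutation. *)
Lemma hecke_traceC x y : hecke_trace (x * y) = hecke_trace (y * x).
Proof.
elim/hecke_ind: x y => [x z IHx IHz|c x IHx||i x IHx] y.
- by rewrite mulrDl mulrDr /hecke_trace !hecke_coefD !ffunE -!/(hecke_trace _) IHx IHz.
- by rewrite -scalerAl -scalerAr /hecke_trace !hecke_coefZ !ffunE -!/(hecke_trace _) IHx.
- by rewrite mul1r mulr1.
have tg z : hecke_trace (hecke_gen q i * z) = hecke_trace (z * hecke_gen q i).
  rewrite /hecke_trace hecke_coefMgen hecke_coefM_gen !ffunE.
  by rewrite invg1 mulg1 mul1g.
by rewrite -mulrA tg -mulrA IHx mulrA.
Qed.

Lemma hecke_projB x y :
  hecke_proj q (x - y) = hecke_proj q x - hecke_proj q y :> hecke q n.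
Proof. by apply/eqP; rewrite eq_sym subr_eq -hecke_projD subrK. Qed.

Lemma hecke_proj_relator x : hecke_relator q x -> hecke_proj q x = 0 :> hecke q n.
Proof.
move=> rx; rewrite -hecke_proj0; apply/hecke_projP; rewrite subr0.
exact/hecke_idealP/Ideal_gen.
Qed.

Lemma hecke_gen_quad i :
  hecke_gen q i * hecke_gen q i = (q - 1) *: hecke_gen q i + q%:A.
Proof.
have := hecke_proj_relator (Quadratic_rel q i).
rewrite hecke_projM hecke_projD hecke_projB hecke_projZ hecke_proj1 -hecke_genE.
rewrite -[hecke_mul _ _]/((hecke_gen q i + 1) * (hecke_gen q i - q%:A)).
rewrite mulrBr mulrDl mul1r -scalerAr mulr1 scalerDr => /eqP.
by rewrite subr_eq0 -(inj_eq (addIr (- hecke_gen q i))) addrK => /eqP->;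
   rewrite scalerBl scale1r addrAC.
Qed.

Lemma hecke_gen_comm i j : (i.+1 < j)%N || (j.+1 < i)%N ->
  hecke_gen q i * hecke_gen q j = hecke_gen q j * hecke_gen q i.
Proof.
move=> /(Commutation_rel q)/hecke_proj_relator r.
have e (k l : 'I_n.-1) : hecke_proj q (free_gen R k * free_gen R l) =
    hecke_gen q k * hecke_gen q l.
  by rewrite hecke_projM -!hecke_genE.
apply/eqP; rewrite -subr_eq0 -e -e; apply/eqP.
exact: etrans (esym (hecke_projB _ _)) r.
Qed.

Lemma hecke_gen_braid i j : j = i.+1 :> nat ->
  hecke_gen q i * hecke_gen q j * hecke_gen q i =
  hecke_gen q j * hecke_gen q i * hecke_gen q j.
Proof.
move=> /(Braid_rel q)/hecke_proj_relator r.
have e (k l : 'I_n.-1) : hecke_proj q (free_gen R k * free_gen R l * free_gen R k) =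
    hecke_gen q k * hecke_gen q l * hecke_gen q k.
  by rewrite hecke_projM hecke_projM -!hecke_genE.
apply/eqP; rewrite -subr_eq0 -e -e; apply/eqP.
exact: etrans (esym (hecke_projB _ _)) r.
Qed.

Lemma hecke_word_cons i a : hecke_word q (i :: a) = hecke_gen q i * hecke_word q a.
Proof. by rewrite /hecke_word big_cons. Qed.

Lemma hecke_coef_reduced w a :
  reduced_decomposition w a -> hecke_coef (hecke_word q a) = delta w.
Proof.
elim: a w => [|i a IHa] w.
  by case=> -> _; rewrite /hecke_word !big_nil hecke_coef1.
move=> /reduced_cons[d /IHa e].
by rewrite hecke_word_cons hecke_coefMgen e opL_delta.
Qed.

End Coefficients.

(* Two reduced words of w with distinct first letters i, j are both compared with a reduced word of w starting with the longest
   element of the group generated by s_i and s_j. *)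
Lemma hecke_word_reduced (R : comNzRingType) (q : R) (n : nat)
    (red : 'S_n -> seq 'I_n.-1)
    (redP : forall w : 'S_n, reduced_decomposition w (red w)) (w : 'S_n)
    (a b : seq 'I_n.-1) :
  reduced_decomposition w a -> reduced_decomposition w b ->
  hecke_word q a = hecke_word q b.
Proof.
have [m] := ubnP (size a); elim: m => // m IHm in w a b *.
case: a => [_ [-> _]|i a]; first by rewrite big_nil => /reduced1 ->.
rewrite ltnS => sza ra.
case: b => [[ew _]|j b rb].
  by move: ra; rewrite ew big_nil => /reduced1.
have [di rai] := reduced_cons ra; have [dj rbj] := reduced_cons rb.
have szb : (size b < m)%N by case: ra rb => _ /= + [_ /= sb]; rewrite -sb => -[<-].
rewrite !hecke_word_cons.
have [eij | nij] := eqVneq i j.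
  by rewrite eij in rai *; rewrite (IHm _ _ _ sza rai rbj).
pose si := adj_transp i; pose sj := adj_transp j.
have [far | near] := boolP ((i.+1 < j)%N || (j.+1 < i)%N).
  set u := red (si * (sj * w))%g.
  have ui : reduced_decomposition (si * w)%g (j :: u).
    apply: cons_reduced; first by rewrite descent_far // orbC.
    have -> : (sj * (si * w))%g = (si * (sj * w))%g.
      by rewrite !mulgA; case/orP: far => /adj_transp_comm ->.
    exact: redP.
  have uj : reduced_decomposition (sj * w)%g (i :: u).
    by apply: cons_reduced; [rewrite descent_far | exact: redP].
  rewrite (IHm _ _ _ sza rai ui) (IHm _ _ _ szb rbj uj) !hecke_word_cons.
  by rewrite !mulrA hecke_gen_comm.
wlog ij : i j a b ra rb sza szb di dj rai rbj nij near @si @sj / j = i.+1 :> nat.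
  move=> H; have : j = i.+1 :> nat \/ i = j.+1 :> nat.
    by move: nij near; rewrite -val_eqE /=; lia.
  case=> [|ji]; first exact: H.
  by symmetry; apply: H; rewrite // 1?eq_sym // orbC.
pose u := red (si * (sj * (si * w)))%g.
have lo_j : adj_lo j = adj_hi i by apply: val_inj.
have fix_i : adj_transp i (adj_hi j) = adj_hi j.
  by apply: val_inj => /=; rewrite val_adj_transp /=; do ![case: eqP] => *; lia.
have fix_j : adj_transp j (adj_lo i) = adj_lo i.
  by apply: val_inj => /=; rewrite val_adj_transp /=; do ![case: eqP] => *; lia.
have jL : adj_transp j (adj_hi i) = adj_hi j by rewrite -lo_j adj_transpL.
have pE := (permM, fix_i, fix_j, jL, adj_transpL, adj_transpR, lo_j).
(* Thus [w] decreases along three consecutive positions, so three letters can be stripped from it in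
   either order, each at a descent. *)
have dij : (w (adj_hi j) < w (adj_lo i))%N.
  by move: di dj; rewrite /descent lo_j => d1 d2; apply: ltn_trans d2 d1.
have ui : reduced_decomposition (si * w)%g [:: j, i & u].
  apply: cons_reduced; first by rewrite /descent !pE.
  apply: cons_reduced; last exact: redP.
  by move: dj; rewrite /descent !pE.
have uj : reduced_decomposition (sj * w)%g [:: i, j & u].
  apply: cons_reduced; first by rewrite /descent !pE.
  apply: cons_reduced; first by move: di; rewrite /descent !pE.
  suff <- : (si * (sj * (si * w)))%g = (sj * (si * (sj * w)))%g by exact: redP.
  by rewrite !mulgA -!(mulgA _ _ (adj_transp _)) adj_transp_braid.
rewrite (IHm _ _ _ sza rai ui) (IHm _ _ _ szb rbj uj) !hecke_word_cons.
by rewrite !mulrA hecke_gen_braid.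
Qed.

(** * The basis of the T_w *)

Section Basis.
Variables (R : comNzRingType) (q : R) (n : nat) (red : 'S_n -> seq 'I_n.-1).
Hypothesis redP : forall w : 'S_n, reduced_decomposition w (red w).
Local Notation T w := (hecke_word q (red w)).

(** This is the linear independence of the T_w, with [hecke_coef] reading off the coordinates. *)
Lemma hecke_word_comb (c : {ffun 'S_n -> R}) :
  hecke_coef (\sum_w c w *: T w) = c.
Proof.
apply/ffunP => u.
have -> : hecke_coef (\sum_w c w *: T w) u = \sum_w hecke_coef (c w *: T w) u.
  apply: (big_morph (fun h => hecke_coef h u)) => [x y|].
    by rewrite hecke_coefD ffunE.
  by rewrite -(scale0r 1) hecke_coefZ ffunE mul0r.
rewrite (bigD1 u) //= hecke_coefZ (hecke_coef_reduced q (redP u)) !ffunE eqxx mulr1.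
rewrite big1 ?addr0 // => w wu.
by rewrite hecke_coefZ (hecke_coef_reduced q (redP w)) !ffunE eq_sym (negPf wu) mulr0.
Qed.

(** The span contains 1 and is stable under left multiplication by T_i: at an ascent T_i T_w is the
    basis element of s_i w; at a descent T_w = T_i T_(s_i w), and the quadratic relation applies. *)
Lemma hecke_word_span (h : hecke q n) :
  exists c : {ffun 'S_n -> R}, h = \sum_w c w *: T w.
Proof.
pose S h := exists c : {ffun 'S_n -> R}, h = \sum_w c w *: T w.
have SD x y : S x -> S y -> S (x + y).
  move=> [c ->] [d ->]; exists (c + d); rewrite -big_split /=.
  by apply: eq_bigr => w _; rewrite ffunE scalerDl.
have SZ a x : S x -> S (a *: x).
  move=> [c ->]; exists [ffun w => a * c w]; rewrite scaler_sumr.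
  by apply: eq_bigr => w _; rewrite ffunE scalerA.
have ST w : S (T w).
  exists (delta R w); rewrite (bigD1 w) //= big1 => [|u uw].
    by rewrite ffunE eqxx scale1r addr0.
  by rewrite ffunE (negPf uw) scale0r.
have S0 : S 0 by rewrite -(scale0r (T 1%g)); apply: (SZ).
elim/hecke_ind: h => //.
  by have := ST 1%g; rewrite (reduced1 (redP 1%g)) /hecke_word big_nil.
move=> i _ [c ->]; rewrite mulr_sumr; elim/big_ind: _ => // w _.
rewrite -scalerAr; apply: (SZ).
have [d|a] := boolP (descent i w).
  have e : T w = hecke_gen q i * T (adj_transp i * w)%g.
    rewrite -hecke_word_cons; apply: (hecke_word_reduced q redP (redP w)).
    exact: cons_reduced.
  rewrite e mulrA hecke_gen_quad mulrDl -!scalerAl mul1r -e.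
  by apply: (SD); apply: (SZ).
rewrite -hecke_word_cons.
rewrite (hecke_word_reduced q redP (b := red (adj_transp i * w)%g) _ (redP _)) //.
by apply: cons_reduced; rewrite ?descent_mul_adj // mulg_adjKl.
Qed.

End Basis.

(** * Staircase products of involutions *)

Section StaircaseOfInvolutions.
Variables (A : pzRingType) (e : nat -> A).
Hypothesis e2 : forall i, e i * e i = 1.
Hypothesis eC : forall i j, (i.+1 < j)%N -> e i * e j = e j * e i.

Definition stair_row m := \prod_(i < m) e i.
Definition stair_row_rev m := \prod_(i < m) e (m - i.+1)%N.

(** With [e 0] standing for E_1, [stair_row m] is C_m and [staircase m] is W_m. Only the [e i] with
    i + 1 < m occur in the latter. *)
Fixpoint staircase m := if m is k.+1 then stair_row k * staircase k else 1.

Lemma stair_rowS m : stair_row m.+1 = stair_row m * e m.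
Proof. exact: big_ord_recr. Qed.

Lemma stair_row_revS m : stair_row_rev m.+1 = e m * stair_row_rev m.
Proof. by rewrite /stair_row_rev big_ord_recl subn1. Qed.

Lemma stair_rowK m : stair_row m * stair_row_rev m = 1.
Proof.
elim: m => [|m IHm]; first by rewrite /stair_row /stair_row_rev !big_ord0 mulr1.
by rewrite stair_rowS stair_row_revS -mulrA (mulrA (e m)) e2 mul1r.
Qed.

Lemma stair_row_revK m : stair_row_rev m * stair_row m = 1.
Proof.
elim: m => [|m IHm]; first by rewrite /stair_row /stair_row_rev !big_ord0 mulr1.
by rewrite stair_rowS stair_row_revS -mulrA (mulrA (stair_row_rev m)) IHm mul1r e2.
Qed.

(** Every factor [e i] has i + 1 < m <= k, so it is far enough from [e k] to commute with it. *)
Lemma staircase_comm m k : (m <= k)%N -> e k * staircase m = staircase m * e k.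
Proof.
elim: m => [|m IHm] mk /=; first by rewrite mulr1 mul1r.
suff rc : e k * stair_row m = stair_row m * e k.
  by rewrite mulrA rc -mulrA IHm ?mulrA // ltnW.
elim: m mk {IHm} => [|m IHm] mk; first by rewrite /stair_row big_ord0 mulr1 mul1r.
by rewrite stair_rowS mulrA IHm ?(ltnW mk) // -!mulrA (eC mk).
Qed.

(* If staircase m and staircase m.+1 are involutions, then staircase m.+1 also
   equals staircase m * stair_row_rev m, whence the conjugation formula, and
   so staircase m.+2 is an involution too. *)
Lemma staircase_conj_sqr m :
  [/\ staircase m * staircase m = 1,
      staircase m.+1 * staircase m.+1 = 1 &
      staircase m.+2 = stair_row m * (e m * staircase m) * stair_row_rev m].
Proof.
have conj k : staircase k * staircase k = 1 ->
    staircase k.+1 * staircase k.+1 = 1 ->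
    staircase k.+2 = stair_row k * (e k * staircase k) * stair_row_rev k.
  move=> sk sk1; rewrite -!mulrA.
  have <- : staircase k.+1 = staircase k * stair_row_rev k.
    have inv : staircase k.+1 * (staircase k * stair_row_rev k) = 1.
      by rewrite /= -mulrA (mulrA (staircase k)) sk mul1r stair_rowK.
    by rewrite -[RHS]mul1r -sk1 -mulrA inv mulr1.
  by rewrite mulrA -stair_rowS.
elim: m => [|m [s0 s1 s2]].
  suff s1 : staircase 1 * staircase 1 = 1 by split; rewrite ?conj ?mulr1.
  by rewrite /= /stair_row big_ord0 !mulr1.
suff s3 : staircase m.+2 * staircase m.+2 = 1 by split=> //; apply: conj.
(* The square is conjugate to that of [e m * staircase m], a product of two commuting
   involutions. *)
rewrite s2 -!mulrA (mulrA (stair_row_rev m)) stair_row_revK mul1r.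
rewrite (mulrA (staircase m)) -staircase_comm // -(mulrA (e m)).
by rewrite (mulrA (staircase m)) s0 mul1r (mulrA (e m)) e2 mul1r stair_rowK.
Qed.

End StaircaseOfInvolutions.

(** * Supports and vanishing traces *)

Section Support.
Variables (R : comNzRingType) (q : R) (n : nat) (i : 'I_n.-1).

(** A condition weaker than lying in the subalgebra generated by the T_j with j < i. It is stable
    under left multiplication by these T_j, and it still excludes s_i from the support. *)
Definition fixed_support (h : hecke q n) : Prop :=
  forall w : 'S_n, w (adj_hi i) != adj_hi i -> hecke_coef h w = 0.

Lemma fixed_support1 : fixed_support 1.
Proof.
move=> w fw; rewrite hecke_coef1 ffunE; have [w1|//] := eqVneq w 1%g.
by move: fw; rewrite w1 perm1 eqxx.
Qed.

Lemma fixed_supportB x y :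
  fixed_support x -> fixed_support y -> fixed_support (x - y).
Proof.
move=> sx sy w fw; rewrite -scaleN1r hecke_coefD hecke_coefZ !ffunE.
by rewrite (sx _ fw) (sy _ fw) mulr0 addr0.
Qed.

Lemma fixed_supportZ c x : fixed_support x -> fixed_support (c *: x).
Proof. by move=> sx w fw; rewrite hecke_coefZ ffunE sx // mulr0. Qed.

Lemma fixed_supportMgen (j : 'I_n.-1) x :
  (j < i)%N -> fixed_support x -> fixed_support (hecke_gen q j * x).
Proof.
move=> ji sx w fw; rewrite hecke_coefMgen ffunE.
have fix_j : adj_transp j (adj_hi i) = adj_hi i.
  by apply: val_inj => /=; rewrite val_adj_transp /=; do ![case: eqP] => *; lia.
by rewrite !sx ?permM ?fix_j // !mulr0 addr0 if_same.
Qed.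

(** As [i] is an ascent of the identity, the trace is q times the coefficient of [x] at s_i, which
    moves [adj_hi i]. *)
Lemma hecke_traceMgen x : fixed_support x -> hecke_trace (hecke_gen q i * x) = 0.
Proof.
move=> sx; rewrite /hecke_trace hecke_coefMgen ffunE mulg1.
rewrite /descent !perm1 /= ltnNge leqnSn /= sx ?mulr0 //.
by rewrite adj_transpR -val_eqE /= ltn_eqF.
Qed.

End Support.

(** * The involutions E_i and the trace recursion *)

Section InvolutiveGenerators.
Variables (F : fieldType) (q : F) (n : nat).
Hypothesis q1 : q + 1 != 0.
Implicit Types (i j : 'I_n.-1) (x : hecke q n).

Definition invol_gen i : hecke q n :=
  (q + 1)^-1 *: ((q - 1)%:A - 2%:R *: hecke_gen q i).

Lemma invol_genM i x :
  invol_gen i * x = (q + 1)^-1 *: ((q - 1) *: x - 2%:R *: (hecke_gen q i * x)).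
Proof. by rewrite /invol_gen -scalerAl mulrBl -!scalerAl mul1r. Qed.

(** The affine map from T_i to E_i sends the roots -1 and q of the quadratic relation to 1 and
    -1. *)
Lemma invol_gen_sqr i : invol_gen i * invol_gen i = 1.
Proof.
have ME : hecke_gen q i * invol_gen i =
    (q + 1)^-1 *: (- (q - 1) *: hecke_gen q i - (2%:R * q)%:A).
  rewrite /invol_gen -scalerAr mulrBr -!scalerAr mulr1 hecke_gen_quad; congr (_ *: _).
  rewrite scalerDr !scalerA opprD addrA -scalerBl; congr (_ *: _ + _).
  by ring.
rewrite invol_genM ME /invol_gen !scalerBr !scalerA opprB addrACA -scalerDl.
rewrite -opprD -scalerDl [X in X *: 1](_ : _ = 1); last by field.
by rewrite [X in X *: hecke_gen q i](_ : _ = 0) ?scale0r ?subr0 ?scale1r //; field.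
Qed.

Lemma invol_gen_comm i j : (i.+1 < j)%N ->
  invol_gen i * invol_gen j = invol_gen j * invol_gen i.
Proof.
move=> ij.
have gE : hecke_gen q i * invol_gen j = invol_gen j * hecke_gen q i.
  rewrite /invol_gen -scalerAr -scalerAl mulrBr mulrBl -!scalerAr -!scalerAl.
  by rewrite mulr1 mul1r hecke_gen_comm ?ij.
rewrite invol_genM gE {2}/invol_gen -scalerAr mulrBr -!scalerAr.
by rewrite mulr1.
Qed.

(* The value 1 out of range makes the relations below hold for all indices. *)
Definition invol_nat (k : nat) : hecke q n := oapp invol_gen 1 (insub k).

Lemma invol_natE i : invol_nat i = invol_gen i.
Proof. by rewrite /invol_nat valK. Qed.

Lemma invol_nat_sqr k : invol_nat k * invol_nat k = 1.
Proof.
rewrite /invol_nat; case: insubP => [i _ _ | _] /=; first exact: invol_gen_sqr.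
exact: mulr1.
Qed.

Lemma invol_nat_comm k l : (k.+1 < l)%N ->
  invol_nat k * invol_nat l = invol_nat l * invol_nat k.
Proof.
rewrite /invol_nat; case: insubP => [i _ <- | _ _] /=; last by rewrite mulr1 mul1r.
case: insubP => [j _ <- | _ _] /=; last by rewrite mulr1 mul1r.
exact: invol_gen_comm.
Qed.

Lemma prod_invol_gen_staircase :
  \prod_(k < n.-1) \prod_(i < n.-1 | (i < n.-1 - k)%N) invol_gen i =
  staircase invol_nat n.
Proof.
have st m : \prod_(k < m) stair_row invol_nat (m - k) = staircase invol_nat m.+1.
  elim: m => [|m IHm]; first by rewrite /= /stair_row !big_ord0 mulr1.
  by rewrite big_ord_recl subn0 IHm.
transitivity (\prod_(k < n.-1) stair_row invol_nat (n.-1 - k)).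
  apply: eq_bigr => k _; rewrite /stair_row (big_ord_widen _ _ (leq_subr k n.-1)).
  by apply: eq_bigr => i _; rewrite invol_natE.
(* The index [m.-1.+1] differs from [m] only for m = 0, where both staircases equal 1. *)
rewrite st; have pS m : staircase invol_nat m.-1.+1 = staircase invol_nat m.
  by case: m => [|m] //; rewrite /= /stair_row big_ord0 mulr1.
exact: pS.
Qed.

Lemma fixed_support_staircase i m :
  (m <= i)%N -> fixed_support i (staircase invol_nat m).
Proof.
elim: m => [|m IHm] mi; first exact: fixed_support1.
(* The support is controlled under left multiplication only, so the factors of the row are absorbed
   into an arbitrary [x], starting from the last one. *)
have row k x : (k <= i)%N -> fixed_support i x ->
    fixed_support i (stair_row invol_nat k * x).
  elim: k x => [|k IHk] x ki sx; first by rewrite /stair_row big_ord0 mul1r.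
  rewrite stair_rowS -mulrA; apply: IHk; first exact: ltnW.
  pose j := Ordinal (ltn_trans ki (ltn_ord i)).
  rewrite -[k]/(val j) invol_natE invol_genM; apply: fixed_supportZ.
  by apply: fixed_supportB; apply: fixed_supportZ => //; apply: fixed_supportMgen.
by apply: row; [apply: ltnW | apply: IHm; apply: ltnW].
Qed.

Lemma hecke_trace_staircase m : (m <= n)%N ->
  hecke_trace (staircase invol_nat m) = ((q - 1) / (q + 1)) ^+ m./2.
Proof.
have t1 : hecke_trace (1 : hecke q n) = 1.
  by rewrite /hecke_trace hecke_coef1 ffunE eqxx.
have [k] := ubnP m; elim: k => // k IHk in m *.
case: m => [|[|m]] mk mn /=; rewrite ?expr0 //.
  by rewrite /stair_row big_ord0 mulr1.
have [_ _ conj] := staircase_conj_sqr invol_nat_sqr invol_nat_comm m.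
rewrite -[stair_row _ _ * _]/(staircase invol_nat m.+2) conj.
(* Cyclicity of the trace removes the conjugation by [stair_row m]. *)
rewrite hecke_traceC (mulrA (stair_row_rev _ _)).
rewrite stair_row_revK; last exact: invol_nat_sqr.
(* Hence [invol_nat m] is a genuine E_(m+1) and not the default value 1. *)
have mn1 : (m < n.-1)%N by rewrite ltn_predRL.
rewrite mul1r -[m in invol_nat m]/(val (Ordinal mn1)) invol_natE invol_genM.
have tg := hecke_traceMgen (fixed_support_staircase (leqnn (Ordinal mn1))).
rewrite /hecke_trace hecke_coefZ ffunE -scaleN1r !scalerA.
rewrite hecke_coefD ffunE !hecke_coefZ !ffunE.
rewrite -!/(hecke_trace _) tg mulr0 addr0.
rewrite IHk; [|lia|lia].
by rewrite exprS mulrA (mulrC _^-1).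
Qed.

End InvolutiveGenerators.

Lemma qvar_addr1_neq0 (K : fieldType) : qvar K + 1 != 0.
Proof.
rewrite /qvar -tofrac1 -tofracD tofrac_eq0 -polyC1.
by rewrite -size_poly_eq0 size_XaddC.
Qed.

Theorem theorem5p1 (K : fieldType) (n : nat) (red : 'S_n -> seq 'I_n.-1)
    (charK : [pchar K] =i pred0)
    (redP : forall w : 'S_n, reduced_decomposition w (red w)) :
  exists2 c : {ffun 'S_n -> {fraction {poly K}}},
    unique (fun c : {ffun 'S_n -> {fraction {poly K}}} =>
      hecke_Eprod K n = \sum_(w : 'S_n) c w *: hecke_word (qvar K) (red w)) c
    & c 1%g = ((qvar K - 1) / (qvar K + 1)) ^+ n./2.
Proof.
have [c ec] := hecke_word_span redP (hecke_Eprod K n).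
(* Any expansion is recovered by [hecke_coef]; this yields uniqueness and turns [c 1] into a
   trace. *)
have coef_c : hecke_coef (hecke_Eprod K n) = c by rewrite ec hecke_word_comb.
exists c; first by split=> // d ed; rewrite -coef_c ed hecke_word_comb.
rewrite -coef_c -(hecke_trace_staircase (qvar_addr1_neq0 K) (leqnn n)).
(* [hecke_E] is [invol_gen] at the generic parameter, by conversion. *)
by rewrite -prod_invol_gen_staircase.
Qed.
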